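(* There exists an absolute constant $c>0$ such that for every $\sigma>0$, every integer $m\ge1$ and all integers $b_1,\dots,b_m\ge 1$, with $B=\sum_{i=1}^m b_i$, \[ \inf_{\hat\theta\in\mathcal{A}(b_1,\dots,b_m)}\ \sup_{\theta\in[0,1]}\mathbb{E}(\hat\theta-\theta)^2\ \ge\ \begin{cases} c\cdot 2^{-2B} & \text{if } B<\log\frac1\sigma+2,\\[2pt] c\cdot\dfrac{\sigma^2}{B-\log\frac1\sigma} & \text{if } \log\frac1\sigma+2\le B<\log\frac1\sigma+m,\\[6pt] c\cdot\min\left\{\dfrac{\sigma^2}{m},1\right\} & \text{if } B\ge\log\frac1\sigma+m. \end{cases} \]
   Context: $\log$ denotes the base-2 logarithm. Setting: $X_1,\dots,X_m$ are i.i.d. $N(\theta,\sigma^2)$ real random variables, where $\theta\in[0,1]$ is unknown and $\sigma>0$ is known; the $i$-th local machine observes $X_i$ only. $\mathcal{A}(b_1,\dots,b_m)$ is the class of distributed protocols with communication budgets $b_1,\dots,b_m$: the $i$-th machine applies a (possibly randomized) map $\Pi_i:\mathbb{R}\to\{0,1\}^{b_i}$ to its own observation $X_i$ to produce a transcript $Z_i=\Pi_i(X_i)$ (internal randomness is independent of the data and across machines), and the estimator $\hat\theta=\hat\theta(Z_1,\dots,Z_m)$ is a real-valued function (possibly randomized with independent internal randomness) of the transcripts only. The protocol may depend on $\sigma,m,b_1,\dots,b_m$ but not on $\theta$. The expectation $\mathbb{E}$ is over the data (for the given $\theta$) and all internal randomness. When the conditions of two cases of the bound hold simultaneously, both corresponding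 bounds are asserted. *)

(* Defs.v *)
From HB Require Import structures.
From mathcomp Require Import all_boot all_order all_algebra.
From mathcomp Require Import all_classical all_reals all_analysis.

Set Implicit Arguments.
Unset Strict Implicit.
Unset Printing Implicit Defensive.

Import Order.TTheory GRing.Theory Num.Theory.
Import numFieldNormedType.Exports.

Local Open Scope classical_set_scope.
Local Open Scope ring_scope.

Definition log2 (R : realType) (x : R) : R := ln x / ln 2.

(* A randomized map is a deterministic measurable map with an additional
   argument, the seed, drawn from a law that the protocol chooses.  There are
   finitely many transcripts, so the estimator only has to be measurable in its
   seed.  No field depends on the unknown parameter. *)
Record protocol (R : realType) (m : nat) (b : 'I_m -> nat) := Protocol {
  seed_display : 'I_m -> measure_display ;
  seed_space : forall i, measurableType (seed_display i) ;
  seed_law : forall i, probability (seed_space i) R ;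
  encoder : forall i, {mfun (R * seed_space i)%type >-> (b i).-tuple bool} ;
  est_seed_display : measure_display ;
  est_seed_space : measurableType est_seed_display ;
  est_seed_law : probability est_seed_space R ;
  estimator : (forall i, (b i).-tuple bool) -> {mfun est_seed_space >-> R}
}.

(* A probability space carrying the observations and all the seeds.  Since any
   of the events in [mutual_independence] may be taken to be the whole space,
   the product rule covers every subfamily. *)
Record sampling (R : realType) (m : nat) (b : 'I_m -> nat) (sigma theta : R)
    (p : protocol R b) := Sampling {
  sample_display : measure_display ;
  sample_space : measurableType sample_display ;
  prob : probability sample_space R ;
  obs : 'I_m -> {RV prob >-> R} ;
  seed : forall i, {RV prob >-> seed_space p i} ;
  est_seed : {RV prob >-> est_seed_space p} ;
  obs_lawE : forall i (A : set R), measurable A ->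
    distribution prob (obs i) A = normal_prob theta sigma A ;
  seed_lawE : forall i (A : set (seed_space p i)), measurable A ->
    distribution prob (seed i) A = seed_law p i A ;
  est_seed_lawE : forall A : set (est_seed_space p), measurable A ->
    distribution prob est_seed A = est_seed_law p A ;
  mutual_independence : forall (A : 'I_m -> set R)
      (C : forall i, set (seed_space p i)) (D : set (est_seed_space p)),
    (forall i, measurable (A i)) -> (forall i, measurable (C i)) ->
    measurable D ->
    prob ((\bigcap_i (obs i @^-1` A i `&` seed i @^-1` C i))
          `&` est_seed @^-1` D) =
    ((\prod_(i < m) (prob (obs i @^-1` A i) * prob (seed i @^-1` C i)))
     * prob (est_seed @^-1` D))%E
}.

Definition transcript (R : realType) (m : nat) (b : 'I_m -> nat)
    (sigma theta : R) (p : protocol R b) (S : sampling sigma theta p)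
    (w : sample_space S) (i : 'I_m) : (b i).-tuple bool :=
  encoder p i (obs S i w, seed S i w).

Definition estimate (R : realType) (m : nat) (b : 'I_m -> nat)
    (sigma theta : R) (p : protocol R b) (S : sampling sigma theta p)
    (w : sample_space S) : R :=
  estimator p (transcript w) (est_seed S w).

Definition mean_squared_error (R : realType) (m : nat) (b : 'I_m -> nat)
    (sigma theta : R) (p : protocol R b) (S : sampling sigma theta p) : \bar R :=
  'E_(prob S)[fun w => (estimate w - theta) ^+ 2].

(* For given [p], [sigma] and [theta], all samplings have the same mean squared
   error, as their joint law is prescribed: ranging over samplings only serves
   to avoid singling out one sample space. *)
Definition worst_case_risk (R : realType) (m : nat) (b : 'I_m -> nat)
    (sigma : R) (p : protocol R b) : \bar R :=
  ereal_sup [set r | exists2 theta : R, 0 <= theta <= 1 &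
    exists S : sampling sigma theta p, r = mean_squared_error S].

Definition minimax_risk (R : realType) (m : nat) (b : 'I_m -> nat)
    (sigma : R) : \bar R :=
  ereal_inf [set r | exists p : protocol R b, r = worst_case_risk sigma p].

(* Main.v *)
Require Import Defs.
From HB Require Import structures.
From mathcomp Require Import all_boot all_order all_algebra.
From mathcomp Require Import all_classical all_reals all_analysis.
From mathcomp Require Import measurable_realfun ring lra.

(* Write p_i, p_i' for the laws of the i-th message under theta and
   theta + delta, alpha = delta / (2 sigma), M = (p_i + p_i') / 2 and
   r = (p_i' - p_i) / (p_i + p_i').  Given the message, r is the conditional mean
   of a function of the Gaussian observation that is subgaussian with variance
   proxy of order alpha^2, so Jensen's inequality gives
   sum_z M(z) e^(l r(z)) <= e^(40 alpha^2 l^2) for all l.  Hence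
   D_i = sum_z M(z) r(z)^2 is at most of order alpha^2, and also at most of order
   alpha^2 times the mean entropy of p_i and p_i'.  As Hellinger affinities
   multiply, the two-point testing error is bounded below by 1/2 - sum_i D_i.

   On the other hand, for theta on a grid of K points, Gibbs' inequality bounds
   the mean entropy of the transcript by
   B ln 2 - ln K + 3 ln 2 + E((theta^ - theta) / spacing)^2.

   - Entropy being nonnegative, K = 32 * 2^B grid points give the risk 2^(-2B).
   - The bound D_i = O(alpha^2) and two points at distance of order
     min(sigma / sqrt m, 1) give the centralized rate.
   - With n = B - L, a grid of spacing sigma leaves the messages only O(n) of
     entropy once theta is located up to sigma; so pairs at distance
     delta = sigma / (40 sqrt n) around the grid points have sum_i D_i <= 1/4 on
     average. *)

Set Implicit Arguments.
Unset Strict Implicit.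
Unset Printing Implicit Defensive.

Import Order.TTheory GRing.Theory Num.Theory.
Import numFieldNormedType.Exports.

Local Open Scope classical_set_scope.
Local Open Scope ring_scope.

(** * Entropy and discrimination of two laws *)

Section elementary.
Context {R : realType}.
Implicit Types x : R.

(** With [expR (- x) >= 1 - x] the difference is at most [x * (2 - x) / (1 - x)], and
    [(2 - x) / (1 - x) <= 3] for [x <= 1 / 2]. *)
Lemma sinh_le3 x : 0 <= x <= 1 / 2 -> expR x - expR (- x) <= 3 * x.
Proof.
move=> /andP[x0 x1].
have h1 := expR_ge1Dx (- x).
have h2 : expR x * expR (- x) = 1 by rewrite expRxMexpNx_1.
have h3 := expR_gt0 x; have h4 := expR_gt0 (- x).
nra.
Qed.

(** By evenness [x >= 0]. If [x <= 1], the left side is [2] plus the square of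
    [expR (x / 2) - expR (- (x / 2))], which [sinh_le3] controls; if [x > 1], both exponentials are
    at most [expR (2 * x ^+ 2)]. *)
Lemma cosh_le x : expR x + expR (- x) <= 2 * expR (2 * x ^+ 2).
Proof.
wlog x0 : x / 0 <= x => [H|].
  have [/H//|/ltW x0] := leP 0 x.
  by have := H (- x); rewrite opprK sqrrN addrC; apply; rewrite oppr_ge0.
have h := expR_ge1Dx (2 * x ^+ 2).
have [x1|x1] := leP x 1.
  have := @sinh_le3 (x / 2).
  have -> : expR x = expR (x / 2) ^+ 2 by rewrite -expRM_natl; congr expR; lra.
  have -> : expR (- x) = expR (- (x / 2)) ^+ 2 by rewrite -expRM_natl; congr expR; lra.
  have h2 := expRxMexpNx_1 (x / 2).
  have h3 : expR (- (x / 2)) <= expR (x / 2) by rewrite ler_expR; lra.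
  move=> /(_ ltac:(lra)) h4.
  have : (expR (x / 2) - expR (- (x / 2))) ^+ 2 <= (3 * (x / 2)) ^+ 2.
    by rewrite ler_sqr ?nnegrE; lra.
  have -> : (3 * (x / 2)) ^+ 2 = 9 / 4 * x ^+ 2 by field.
  have -> : expR (x / 2) ^+ 2 + expR (- (x / 2)) ^+ 2 =
    (expR (x / 2) - expR (- (x / 2))) ^+ 2 + 2 * (expR (x / 2) * expR (- (x / 2))) by ring.
  rewrite h2.
  by have := sqr_ge0 x; lra.
have : expR (- x) <= expR x by rewrite ler_expR; lra.
have : expR x <= expR (2 * x ^+ 2) by rewrite ler_expR; nra.
lra.
Qed.

(* The linear term has mean [0] in the application, which leaves a symmetric
   bound, without a factor that would spoil the limit of small [x]. *)
Lemma expR_le_cosh2 x : expR x <= x + (expR (2 * x) + expR (- (2 * x))) / 2.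
Proof.
rewrite -mulrN !expRM_natl.
have h := expR_ge1Dx (- x).
have h2 := expRxMexpNx_1 x.
have := expR_gt0 x; have := expR_gt0 (- x).
set u := expR x in h2 *; set v := expR (- x) in h h2 *.
move=> v0 u0.
have uv : 2 <= u + v.
  rewrite -ler_sqr ?nnegrE; [|lra|lra].
  have -> : (u + v) ^+ 2 = (u - v) ^+ 2 + 4 * (u * v) by ring.
  by rewrite h2; have := sqr_ge0 (u - v); lra.
have : 0 <= (u + v) * (u + v - 2) by apply: mulr_ge0; lra.
have -> : (u + v) * (u + v - 2) = u ^+ 2 + v ^+ 2 + 2 * (u * v) - 2 * u - 2 * v by ring.
rewrite h2; lra.
Qed.

(** For [x >= 0] the right side is the square of [expR (x / 2) - expR (- (x / 2))], itself at least
    [x / 2]. *)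
Lemma sqr_le_cosh x : x ^+ 2 / 4 <= expR x + expR (- x) - 2.
Proof.
wlog x0 : x / 0 <= x => [H|].
  have [/H//|/ltW x0] := leP 0 x.
  by have := H (- x); rewrite opprK sqrrN [expR (-x) + _]addrC; apply; rewrite oppr_ge0.
have -> : expR x = expR (x / 2) ^+ 2 by rewrite -expRM_natl; congr expR; lra.
have -> : expR (- x) = expR (- (x / 2)) ^+ 2 by rewrite -expRM_natl; congr expR; lra.
have h := expR_ge1Dx (x / 2).
have h1 : expR (- (x / 2)) <= 1 by rewrite expR_le1; lra.
have h2 := expRxMexpNx_1 (x / 2).
nra.
Qed.

(** One term of Gibbs' inequality, from [ln (w / p) <= w / p - 1]. Keeping [w - p] allows weights
    that are not normalised. *)
Lemma mulr_ln_le (p w : R) : 0 <= p -> 0 < w -> - (p * ln p) <= - (p * ln w) + w - p.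
Proof.
move=> p0 w0; have [->|pn0] := eqVneq p 0; first by lra.
have {p0 pn0} p0 : 0 < p by rewrite lt_def pn0.
have h : ln (w / p) <= w / p - 1.
  by rewrite -{1}[w/p](subrKC 1); apply: le_ln1Dx; rewrite ltrBrDl subrr divr_gt0.
rewrite ln_div ?posrE// in h.
have h2 : p * (w / p) = w by rewrite mulrC divfK // gt_eqF.
nra.
Qed.

Lemma expR_half_le2 : expR (1 / 2) <= 2 :> R.
Proof.
have := expR_ge1Dx (- (1 / 2) : R); have := expRxMexpNx_1 (1 / 2 : R).
have := expR_gt0 (1 / 2 : R); nra.
Qed.

Lemma ln2_ge_half : 1 / 2 <= ln 2 :> R.
Proof. by rewrite -[leLHS]expRK ler_ln ?posrE ?expR_gt0// expR_half_le2. Qed.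

Lemma ln2_le1 : ln 2 <= 1 :> R.
Proof. by have := @le_ln1Dx R 1; rewrite (_ : 1 + 1 = 2)//; apply; lra. Qed.

End elementary.

Section contrast.
Context {R : realType} {T : finType}.
Implicit Types p q : T -> R.

Definition pmf_on p := (forall z, 0 <= p z) /\ \sum_z p z = 1.

(** In nats, so that bits come with a factor [ln 2]. *)
Definition entropy p := - \sum_z p z * ln (p z).

(** Half the triangular discrimination of Vincze and Le Cam; equally, the chi-square divergence of
    either law from their midpoint. *)
Definition discrimination p q := \sum_z (q z - p z) ^+ 2 / (2 * (p z + q z)).

Definition midpoint p q z := (p z + q z) / 2.

(* Null, as a quotient by [0], where both laws vanish. *)
Definition contrast p q z := (q z - p z) / (p z + q z).

(** For two probability laws the contrast has mean [0] under the midpoint, so this is subgaussianity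
    with variance proxy [2 * A]. *)
Definition subgaussian_contrast (A : R) p q := forall l,
  \sum_z midpoint p q z * expR (l * contrast p q z) <= expR (A * l ^+ 2).

Lemma pmf_le1 p z : pmf_on p -> p z <= 1.
Proof.
move=> [p0 <-]; rewrite (bigD1 z)//= lerDl; exact: sumr_ge0.
Qed.

Lemma midpoint_pmf p q : pmf_on p -> pmf_on q -> pmf_on (midpoint p q).
Proof.
move=> [p0 p1] [q0 q1]; split=> [z|].
  by rewrite /midpoint divr_ge0// addr_ge0.
by rewrite -mulr_suml big_split/= p1 q1; lra.
Qed.

Lemma entropy_ge0 p : pmf_on p -> 0 <= entropy p.
Proof.
move=> pp; rewrite oppr_ge0; apply: sumr_le0 => z _.
by rewrite mulr_ge0_le0 ?(pp.1)// ln_le0// pmf_le1.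
Qed.

Lemma discrimination_term p q z : 0 <= p z -> 0 <= q z ->
  (q z - p z) ^+ 2 / (2 * (p z + q z)) = midpoint p q z * contrast p q z ^+ 2.
Proof.
rewrite /midpoint /contrast => p0 q0.
have [s0|s0] := eqVneq (p z + q z) 0; first by rewrite s0 invr0; lra.
by field.
Qed.

Lemma discrimination_ge0 p q : pmf_on p -> pmf_on q -> 0 <= discrimination p q.
Proof.
move=> [p0 _] [q0 _]; apply: sumr_ge0 => z _.
by rewrite divr_ge0 ?sqr_ge0// mulr_ge0 ?addr_ge0.
Qed.

(* A single term of the hypothesis, at [l = r / (2 A)], gives
   [r ^+ 2 <= - 4 A ln M]. *)
Lemma discrimination_le_entropy A p q : 0 < A -> pmf_on p -> pmf_on q ->
  subgaussian_contrast A p q ->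
  discrimination p q <= 4 * A * entropy (midpoint p q).
Proof.
move=> A0 pp pq sub.
have [m0 m1] := midpoint_pmf pp pq.
rewrite /entropy mulrN mulr_sumr -sumrN; apply: ler_sum => z _.
rewrite discrimination_term ?(pp.1) ?(pq.1)//.
have [->|mn0] := eqVneq (midpoint p q z) 0; first by rewrite !mul0r mulr0 oppr0.
have {mn0} mp : 0 < midpoint p q z by rewrite lt_def mn0 m0.
set r := contrast p q z; set M := midpoint _ _ _.
have : M * expR (r / (2 * A) * r) <= expR (A * (r / (2 * A)) ^+ 2).
  apply: le_trans (sub (r / (2 * A))).
  rewrite (bigD1 z)//= lerDl; apply: sumr_ge0 => y _.
  by rewrite mulr_ge0 ?expR_ge0.
rewrite -(ler_ln (mulr_gt0 mp (expR_gt0 _)) (expR_gt0 _)).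
rewrite lnM ?posrE ?expR_gt0// !expRK.
have -> : A * (r / (2 * A)) ^+ 2 = r ^+ 2 / (4 * A) by field; lra.
have -> : r / (2 * A) * r = 2 * (r ^+ 2 / (4 * A)) by field; lra.
have e : r ^+ 2 / (4 * A) * (4 * A) = r ^+ 2 by rewrite divfK//; lra.
move: e; set s := r ^+ 2 / (4 * A) => e h; rewrite -e.
have AM : 0 < 4 * A * M by apply: mulr_gt0 => //; lra.
have : 0 <= 4 * A * M * (- ln M - s) by apply: mulr_ge0; lra.
lra.
Qed.

(** Adding the hypothesis at [l] and [- l] cancels the linear term, and the second-order bound on
    cosh leaves [2 + l ^+ 2 / 4 * D <= 2 * expR (A * l ^+ 2)]. The choice [A * l ^+ 2 = 1 / 2] makes
    the right side at most [4]. *)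
Lemma discrimination_le A p q : 0 < A -> pmf_on p -> pmf_on q ->
  subgaussian_contrast A p q -> discrimination p q <= 16 * A.
Proof.
move=> A0 pp pq sub.
have [m0 m1] := midpoint_pmf pp pq.
pose l := Num.sqrt (2 * A)^-1.
have l2 : l ^+ 2 = (2 * A)^-1 by rewrite sqr_sqrtr// invr_ge0; lra.
have h1 := sub l; have h2 := sub (- l).
have Al : A * l ^+ 2 = 1 / 2 by rewrite l2; field; lra.
rewrite sqrrN Al in h2; rewrite Al in h1.
suff : 2 + l ^+ 2 / 4 * discrimination p q <=
    \sum_z midpoint p q z * expR (l * contrast p q z) +
    \sum_z midpoint p q z * expR (- l * contrast p q z).
  have := expR_half_le2 (R := R).
  have e : l ^+ 2 * (2 * A) = 1 by rewrite l2 mulVf//; lra.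
  set D := discrimination p q => e2 h3.
  have h4 : l ^+ 2 * D <= 8 by lra.
  have -> : D = l ^+ 2 * D * (2 * A) by rewrite mulrAC e mul1r.
  rewrite (_ : 16 * A = 8 * (2 * A)); [|by ring].
  by apply: ler_wpM2r => //; lra.
have {1}-> : 2 = \sum_z 2 * midpoint p q z by rewrite -mulr_sumr m1 mulr1.
rewrite /discrimination mulr_sumr -!big_split/=.
apply: ler_sum => z _; rewrite discrimination_term ?(pp.1) ?(pq.1)//.
have := ler_wpM2l (m0 z) (sqr_le_cosh (l * contrast p q z)).
by rewrite mulNr exprMn; lra.
Qed.

(** The excess of the midpoint's entropy is the Jensen-Shannon divergence, a mean of two relative
    entropies to the midpoint; each is bounded by its chi-square divergence, termwise in [key]. *)
Lemma entropy_midpoint p q : pmf_on p -> pmf_on q ->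
  entropy (midpoint p q) <= (entropy p + entropy q) / 2 + discrimination p q.
Proof.
move=> pp pq.
rewrite /entropy -opprD -big_split/= mulNr mulr_suml -!sumrN -big_split/=.
apply: ler_sum => z _.
have := (pp.1 z); have := (pq.1 z) => q0 p0.
have [m0|mn0] := eqVneq (p z + q z) 0.
  rewrite /midpoint; have [-> ->] : p z = 0 /\ q z = 0 by split; lra.
  by rewrite subrr !mul0r !addr0 expr0n/= !mul0r oppr0.
have s0 : 0 < p z + q z by rewrite lt_def mn0 addr_ge0.
have M0 : 0 < midpoint p q z by rewrite /midpoint; lra.
set M := midpoint p q z in M0 *.
have key (a : R) : 0 <= a -> a * ln a - a * ln M <= a ^+ 2 / M - a.
  move=> a0; have [->|an0] := eqVneq a 0; first by lra.
  have {an0} a0' : 0 < a by rewrite lt_def an0.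
  have h : ln (a / M) <= a / M - 1.
    by rewrite -{1}[a/M](subrKC 1); apply: le_ln1Dx; rewrite ltrBrDl subrr divr_gt0.
  rewrite ln_div ?posrE// in h.
  by have := ler_wpM2l a0 h; rewrite expr2 -mulrA; lra.
have h1 := key _ p0; have h2 := key _ q0.
have : (q z - p z) ^+ 2 / (2 * (p z + q z)) =
    (p z ^+ 2 / M + q z ^+ 2 / M) / 2 - M.
  by rewrite /M /midpoint; field.
have : (p z + q z) / 2 * ln M = M * ln M by [].
have : (p z + q z) / 2 = M by [].
lra.
Qed.

(** Chaining the two preceding entropy bounds puts [4 * A * discrimination p q] on the right, at
    most half of the left side, which absorbs it. *)
Lemma discrimination_le_mean_entropy A p q : 0 < A -> 4 * A <= 1 / 2 ->
  pmf_on p -> pmf_on q -> subgaussian_contrast A p q ->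
  discrimination p q <= 4 * A * (entropy p + entropy q).
Proof.
move=> A0 A1 pp pq sub.
have h1 := discrimination_le_entropy A0 pp pq sub.
have h2 := entropy_midpoint pp pq.
have := discrimination_ge0 pp pq.
have := entropy_ge0 pp; have := entropy_ge0 pq.
nra.
Qed.

(* [1 - discrimination p q] is the sum of the harmonic means of [p] and [q]. *)
Lemma affinity_bounds p q : pmf_on p -> pmf_on q ->
  1 - discrimination p q <= \sum_z Num.sqrt (p z * q z) <= 1.
Proof.
move=> pp pq; have [m0 m1] := midpoint_pmf pp pq.
apply/andP; split.
  rewrite lerBlDr -m1 /discrimination -big_split/=.
  apply: ler_sum => z _.
  have := (pp.1 z); have := (pq.1 z) => q0 p0.
  have [s0|sn0] := eqVneq (p z + q z) 0.
    by rewrite /midpoint s0 mul0r addr_ge0 ?sqrtr_ge0// mulr0 invr0 mulr0.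
  have {sn0}s0 : 0 < p z + q z by rewrite lt_def sn0 addr_ge0.
  have -> : (q z - p z) ^+ 2 / (2 * (p z + q z)) =
     midpoint p q z - 2 * (p z * q z) / (p z + q z).
    by rewrite /midpoint; field; lra.
  suff : 2 * (p z * q z) / (p z + q z) <= Num.sqrt (p z * q z) by lra.
  have := sqr_sqrtr (mulr_ge0 p0 q0).
  have := sqrtr_ge0 (p z * q z).
  set x := Num.sqrt _ => x0 x2.
  rewrite ler_pdivrMr// -x2.
  have : 2 * x <= p z + q z.
    rewrite -ler_sqr ?nnegrE ?mulr_ge0 ?addr_ge0//.
    have := sqr_ge0 (p z - q z); nra.
  nra.
rewrite -m1; apply: ler_sum => z _.
have p0 := pp.1 z; have q0 := pq.1 z.
rewrite -ler_sqr ?nnegrE ?sqrtr_ge0// sqr_sqrtr ?mulr_ge0// /midpoint.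
have := sqr_ge0 (p z - q z); nra.
Qed.

End contrast.

(** * Product laws and the two-point method *)

Section joint.
Context {R : realType} {I : finType} {T : I -> finType}.
Implicit Types p q : forall i, T i -> R.

Lemma sum_fprod_prod (F : forall i, T i -> R) :
  \sum_(z : fprod T) \prod_i F i (z i) = \prod_i \sum_x F i x.
Proof.
pose G i : {ffun T i -> R} := [ffun x => F i x].
transitivity (\sum_(z : fprod T) \prod_(i in I) G i (z i)).
  by apply: eq_bigr => z _; apply: eq_bigr => i _; rewrite ffunE.
(* [big_fprod] replaces dependent functions by plain ones into the tagged union, where
   distributivity applies; [untag] takes the default [0] off the matching tag. *)
rewrite big_fprod -(bigA_distr_big_dep _ (fun i => untag 0 (G i))).
apply: eq_bigr => i _; apply/esym; transitivity (\sum_x G i x); last first.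
  by rewrite (big_tag (fun i => G i)).
by apply: eq_bigr => x _; rewrite ffunE.
Qed.

Definition joint p (z : fprod T) : R := \prod_i p i (z i).

Lemma joint_pmf p : (forall i, pmf_on (p i)) -> pmf_on (joint p).
Proof.
move=> pp; split=> [z|]; first by apply: prodr_ge0 => i _; exact: (pp i).1.
by rewrite sum_fprod_prod big1// => i _; exact: (pp i).2.
Qed.

Lemma sum_joint_marginal p (f : forall i, T i -> R) i :
  (forall j, pmf_on (p j)) ->
  \sum_z joint p z * f i (z i) = \sum_x p i x * f i x.
Proof.
move=> pp.
pose F j x := p j x * (if j == i then f j x else 1).
transitivity (\sum_(z : fprod T) \prod_j F j (z j)).
  apply: eq_bigr => z _; rewrite /joint /F big_split/=; congr (_ * _).
  by rewrite (bigD1 i)//= eqxx big1 ?mulr1// => j /negbTE->.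
rewrite sum_fprod_prod (bigD1 i)//= [X in _ * X]big1 ?mulr1.
  by apply: eq_bigr => x _; rewrite /F eqxx.
move=> j ji; rewrite -[RHS](pp j).2; apply: eq_bigr => x _.
by rewrite /F (negbTE ji) mulr1.
Qed.

Lemma entropy_joint p : (forall i, pmf_on (p i)) ->
  entropy (joint p) = \sum_i entropy (p i).
Proof.
move=> pp; rewrite /entropy sumrN; congr -%R.
transitivity (\sum_(z : fprod T) \sum_i joint p z * ln (p i (z i))).
  apply: eq_bigr => z _; rewrite -mulr_sumr.
  have [->|j0] := eqVneq (joint p z) 0; first by rewrite !mul0r.
  congr (_ * _).
  have pz i : 0 < p i (z i).
    rewrite lt_def (pp i).1 andbT; apply: contraNneq j0 => pi0.
    by rewrite /joint (bigD1 i)//= pi0 mul0r.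
  (* Positivity is carried through the induction because [lnM] requires it of both factors. *)
  suff [] : ln (joint p z) = \sum_i ln (p i (z i)) /\ 0 < joint p z by [].
  rewrite /joint; elim/big_ind2 : _ => [|a b c d [<- b0] [<- d0]|//].
    by rewrite ln1.
  by rewrite lnM ?posrE// mulr_gt0.
rewrite exchange_big/=; apply: eq_bigr => i _.
exact: (sum_joint_marginal (fun i x => ln (p i x))).
Qed.

(** Weierstrass' product inequality: the induction step is [0 <= (1 - b) * (1 - d)], for partial
    products kept in [[0, 1]]. *)
Lemma prod_ge_1sub_sum (r D : I -> R) :
  (forall i, 1 - D i <= r i <= 1) -> (forall i, 0 <= D i) -> (forall i, 0 <= r i) ->
  1 - \sum_i D i <= \prod_i r i.
Proof.
move=> rD D0 r0.
suff [] : 1 - \sum_i D i <= \prod_i r i /\ 0 <= \prod_i r i <= 1 by [].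
elim/big_ind2 : _ => [|a b c d [ab /andP[b0 b1]] [cd /andP[d0 d1]]|i _]; first lra.
  split; last by rewrite mulr_ge0// mulr_ile1.
  have : 0 <= (1 - b) * (1 - d) by rewrite mulr_ge0 ?subr_ge0.
  lra.
by have := rD i; have := r0 i; split; lra.
Qed.

(** The two squared errors add up to at least [(b - a) ^+ 2 / 2], here weighted by the smaller of
    [x] and [y]. For [x <= y], the arithmetic-geometric inequality gives
    [Num.sqrt (x * y) <= x + y / 4], so this weight dominates the bracket. Summed over two laws, the
    subtracted quarter costs [1 / 2]. *)
Lemma two_point_pointwise (x y u a b : R) : 0 <= x -> 0 <= y ->
  (b - a) ^+ 2 / 2 * (Num.sqrt (x * y) - (x + y) / 4) <=
  x * (u - a) ^+ 2 + y * (u - b) ^+ 2.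
Proof.
wlog xy : x y a b / x <= y => [H|] x0 y0.
  have [xy|/ltW yx] := leP x y; first exact: H.
  have := H y x b a yx y0 x0.
  by rewrite -(opprB b a) sqrrN (mulrC y x) (addrC y x) [X in _ <= X]addrC.
have s0 := sqrtr_ge0 (x * y).
have sx : Num.sqrt (x * y) - (x + y) / 4 <= x.
  suff : Num.sqrt (x * y) <= x + y / 4 by lra.
  rewrite -ler_sqr ?nnegrE; [|lra|lra].
  rewrite sqr_sqrtr ?mulr_ge0//.
  have -> : (x + y / 4) ^+ 2 = x * y + (x - y / 4) ^+ 2 by field.
  by rewrite lerDl sqr_ge0.
apply: (@le_trans _ _ (x * ((b - a) ^+ 2 / 2))).
  by rewrite mulrC; apply: ler_wpM2r => //; rewrite divr_ge0 ?sqr_ge0.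
apply: (@le_trans _ _ (x * ((u - a) ^+ 2 + (u - b) ^+ 2))).
  apply: ler_wpM2l => //.
  have -> : (u - a) ^+ 2 + (u - b) ^+ 2 = (b - a) ^+ 2 / 2 + (2 * u - a - b) ^+ 2 / 2 by field.
  by rewrite lerDl divr_ge0 ?sqr_ge0.
by rewrite mulrDr lerD2l ler_wpM2r ?sqr_ge0.
Qed.

(** Le Cam's method: the affinity of the joint laws is the product of the affinities, each at least
    [1] minus the discrimination. *)
Lemma two_point_risk p q (t : fprod T -> R) (a b : R) :
  (forall i, pmf_on (p i)) -> (forall i, pmf_on (q i)) ->
  (b - a) ^+ 2 / 2 * (1 / 2 - \sum_i discrimination (p i) (q i)) <=
  \sum_z (joint p z * (t z - a) ^+ 2 + joint q z * (t z - b) ^+ 2).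
Proof.
move=> pp pq.
have [P0 P1] := joint_pmf pp; have [Q0 Q1] := joint_pmf pq.
have aff : 1 - \sum_i discrimination (p i) (q i) <=
    \sum_z Num.sqrt (joint p z * joint q z).
  rewrite (eq_bigr (fun z : fprod T => \prod_i Num.sqrt (p i (z i) * q i (z i)))); last first.
    move=> z _; rewrite /joint -big_split/=.
    suff [] : Num.sqrt (\prod_i (p i (z i) * q i (z i))) =
      \prod_i Num.sqrt (p i (z i) * q i (z i)) /\ 0 <= \prod_i (p i (z i) * q i (z i)) by [].
    elim/big_ind2 : _ => [|x x' y y' [<- x0] [<- y0]|i _]; first by rewrite sqrtr1.
      by rewrite sqrtrM// mulr_ge0.
    by rewrite mulr_ge0 ?(pp i).1 ?(pq i).1.
  rewrite (sum_fprod_prod (fun i x => Num.sqrt (p i x * q i x))).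
  apply: prod_ge_1sub_sum => i.
  - exact: affinity_bounds.
  - exact: discrimination_ge0.
  - by apply: sumr_ge0 => x _; exact: sqrtr_ge0.
apply: (@le_trans _ _ (\sum_z (b - a) ^+ 2 / 2 *
    (Num.sqrt (joint p z * joint q z) - (joint p z + joint q z) / 4))).
  rewrite -mulr_sumr; apply: ler_wpM2l; first by rewrite divr_ge0 ?sqr_ge0.
  by rewrite big_split/= sumrN -mulr_suml big_split/= P1 Q1; lra.
by apply: ler_sum => z _; exact: two_point_pointwise.
Qed.

(** Entropies of independent messages add up, so the bounds for the machines merge into one on the
    entropy of the whole transcript, however the budget is split. *)
Lemma two_point_entropy_risk (A : R) p q (t : fprod T -> R) (a b : R) :
  0 < A -> 4 * A <= 1 / 2 ->
  (forall i, pmf_on (p i)) -> (forall i, pmf_on (q i)) ->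
  (forall i, subgaussian_contrast A (p i) (q i)) ->
  (b - a) ^+ 2 / 2 *
    (1 / 2 - 4 * A * (entropy (joint p) + entropy (joint q))) <=
  \sum_z joint p z * (t z - a) ^+ 2 + \sum_z joint q z * (t z - b) ^+ 2.
Proof.
move=> A0 A1 pp pq sub; have := two_point_risk t a b pp pq.
rewrite big_split/=; apply: le_trans.
apply: ler_wpM2l; first by rewrite divr_ge0 ?sqr_ge0.
rewrite lerD2l lerN2 !entropy_joint// -big_split/= mulr_sumr.
by apply: ler_sum => i _; exact: discrimination_le_mean_entropy.
Qed.

End joint.

(** * Entropy of laws indexed by a grid *)

Section grid.
Context {R : realType}.

(* The increments [sigmoid (x + 1) - sigmoid x] dominate [expR (- x ^+ 2) / 4] and
   telescope to a bounded sum: they serve as discrete Gaussian weights. *)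
Definition sigmoid (x : R) : R := x / (1 + `|x|).

(** If [x] and [x + 1] lie on the same side of [0], the increment is the inverse of the product of
    [1 + |x|] and [1 + |x + 1|]. Otherwise, comparison of [sigmoid] with the line of slope [1 / 4]
    on both sides of [0] gives at least [1 / 4]. *)
Lemma sigmoid_step_ge (x : R) :
  1 / (4 * (1 + x ^+ 2)) <= sigmoid (x + 1) - sigmoid x.
Proof.
rewrite /sigmoid.
have x2 := sqr_ge0 x.
have [x0|x0] := leP 0 x.
  rewrite !ger0_norm//; [|lra].
  have -> : (x + 1) / (1 + (x + 1)) - x / (1 + x) = 1 / ((1 + (x + 1)) * (1 + x)).
    by field; apply/andP; split; apply: lt0r_neq0; lra.
  rewrite !div1r lef_pV2 ?posrE; [|apply: mulr_gt0; lra|apply: mulr_gt0; lra].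
  have := sqr_ge0 (x - 1 / 2); nra.
have [x1|x1] := leP x (- 1).
  rewrite !ler0_norm//; [|lra|lra].
  have -> : (x + 1) / (1 - (x + 1)) - x / (1 - x) = 1 / ((- x) * (1 - x)).
    by field; apply/and3P; split; [rewrite gt_eqF//; lra|rewrite lt_eqF|rewrite gt_eqF//; lra].
  rewrite !div1r lef_pV2 ?posrE; [|apply: mulr_gt0; lra|apply: mulr_gt0; lra].
  nra.
rewrite ger0_norm ?ltr0_norm//; [|lra].
apply: (@le_trans _ _ (1 / 4)).
  by rewrite !div1r lef_pV2 ?posrE; lra.
have -> : (x + 1) / (1 + (x + 1)) - x / (1 - x) =
   1 / 4 + ((x + 1) / (1 + (x + 1)) - (x + 1) / 4) + (- x / (1 - x) + x / 4).
  by ring.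
have h1 : (x + 1) / 4 <= (x + 1) / (1 + (x + 1)).
  by apply: ler_wpM2l; [lra|rewrite lef_pV2 ?posrE; lra].
have h2 : (- x) / 4 <= (- x) / (1 - x).
  by apply: ler_wpM2l; [lra|rewrite lef_pV2 ?posrE; lra].
lra.
Qed.

Lemma sigmoid_norm_le1 (x : R) : `|sigmoid x| <= 1.
Proof.
rewrite /sigmoid normrM normfV (ger0_norm (_ : 0 <= 1 + _)) ?addr_ge0//.
by rewrite ler_pdivrMr ?mul1r ?lerDr// ltr_wpDr.
Qed.

Lemma sum_sigmoid_step_le (K : nat) (t : R) :
  \sum_(k < K) (sigmoid (k%:R - t + 1) - sigmoid (k%:R - t)) <= 2.
Proof.
rewrite (eq_bigr (fun k : 'I_K => sigmoid (k.+1%:R - t) - sigmoid (k%:R - t))); last first.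
  by move=> k _; rewrite -natr1; congr (sigmoid _ - _); ring.
rewrite -(big_mkord xpredT (fun k => sigmoid (k.+1%:R - t) - sigmoid (k%:R - t))).
rewrite telescope_sumr//.
have := sigmoid_norm_le1 (K%:R - t); have := sigmoid_norm_le1 (0%:R - t).
by rewrite !ler_norml; lra.
Qed.

(* Gibbs' inequality for the weights [K / (2 #|T|) * s k z], [s] being the sigmoid
   increment at [k - t z]. *)
Lemma grid_entropy (T : finType) (K : nat) (P : 'I_K -> T -> R) (t : T -> R) :
  (0 < K)%N -> (forall k, pmf_on (P k)) ->
  \sum_k entropy (P k) <= K%:R * (ln #|T|%:R - ln K%:R + 3 * ln 2) +
    \sum_k \sum_z P k z * (k%:R - t z) ^+ 2.
Proof.
move=> K0 pP.
have N0 : (0 < #|T|)%N.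
  rewrite lt0n; apply: contraPneq (pP (Ordinal K0)).2 => /card0_eq T0.
  by rewrite big_pred0// => /esym/eqP; rewrite oner_eq0.
have KR : 0 < K%:R :> R by rewrite ltr0n.
have NR : 0 < #|T|%:R :> R by rewrite ltr0n.
pose s (k : 'I_K) z := sigmoid (k%:R - t z + 1) - sigmoid (k%:R - t z).
have s_ge (k : 'I_K) z : expR (- ((k : nat)%:R - t z) ^+ 2) / 4 <= s k z.
  apply: le_trans (sigmoid_step_ge _).
  have := expR_ge1Dx ((k%:R - t z) ^+ 2); rewrite expRN => h.
  have := sqr_ge0 (k%:R - t z) => h2.
  rewrite div1r invfM mulrC; apply: ler_wpM2l; first by rewrite invr_ge0.
  by rewrite lef_pV2// posrE; [apply: expR_gt0|lra].
have s_gt k z : 0 < s k z by apply: lt_le_trans (s_ge k z); rewrite divr_gt0 ?expR_gt0.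
pose c : R := K%:R / (2 * #|T|%:R).
have c0 : 0 < c by rewrite divr_gt0// mulr_gt0.
pose W k z := c * s k z.
have W0 k z : 0 < W k z by rewrite mulr_gt0.
(* The term [3 * ln 2] collects [ln 2] from the [2] in [c] and [ln 4] from the factor [1 / 4] in
   [s_ge]. *)
have lnW (k : 'I_K) z : - ln (W k z) <= ln #|T|%:R - ln K%:R + 3 * ln 2 + (k%:R - t z) ^+ 2.
  rewrite lnM ?posrE// /c ln_div ?posrE ?mulr_gt0// lnM ?posrE//.
  have : ln (expR (- (k%:R - t z) ^+ 2) / 4) <= ln (s k z).
    by rewrite ler_ln ?posrE// divr_gt0// expR_gt0.
  rewrite ln_div ?posrE ?expR_gt0// expRK.
  have -> : ln 4 = 2 * ln 2 :> R.
    by rewrite (_ : 4 = 2 ^+ 2)//; [rewrite lnXn// mulr_natl|ring].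
  lra.
(* Only the total mass matters, not that of each [W k]: for fixed [z] the sum over [k] telescopes to
   at most [2], wherever [t z] lies. *)
have sumW : \sum_k \sum_z W k z <= K%:R.
  rewrite exchange_big/= (@le_trans _ _ (\sum_(z : T) c * 2))//.
    apply: ler_sum => z _; rewrite -mulr_sumr; apply: ler_wpM2l; first exact: ltW.
    exact: sum_sigmoid_step_le.
  rewrite sumr_const -mulr_natl /c le_eqVlt; apply/orP; left; apply/eqP; field.
  exact: lt0r_neq0.
apply: (@le_trans _ _ (\sum_k \sum_z (P k z * (ln #|T|%:R - ln K%:R + 3 * ln 2
   + (k%:R - t z) ^+ 2) + W k z - P k z))).
  apply: ler_sum => k _; rewrite /entropy -sumrN; apply: ler_sum => z _.
  apply: (le_trans (mulr_ln_le ((pP k).1 z) (W0 k z))).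
  by rewrite lerB// lerD2r -mulrN ler_wpM2l// (pP k).1.
set C := ln _ - _ + _; clearbody C.
rewrite (eq_bigr (fun k : 'I_K => C + \sum_z P k z * (k%:R - t z) ^+ 2 + \sum_z W k z - 1)); last first.
  move=> k _; rewrite big_split/= big_split/= sumrN (pP k).2; congr (_ + _ - _).
  rewrite -[C in RHS]mul1r -(pP k).2 mulr_suml -big_split/=.
  by apply: eq_bigr => z _; rewrite mulrDr.
rewrite !big_split/= !sumr_const card_ord -(mulr_natl C) mulNrn.
move: sumW; lra.
Qed.

End grid.

(** * Channels fed by a Gaussian observation *)

Section has_integral.
Context {R : realType}.
Local Notation mu := lebesgue_measure.
Implicit Types f g : R -> R.

(** Bundling integrability with the value lets linear combinations and comparisons go through
    without side conditions. *)
Definition has_integral f (v : R) :=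
  mu.-integrable setT (EFin \o f) /\ (\int[mu]_x f x) = v.

Lemma has_integralD f g u v : has_integral f u -> has_integral g v ->
  has_integral (fun x => f x + g x) (u + v).
Proof.
move=> [fi <-] [gi <-]; split; last by rewrite RintegralD.
exact: (integrableD measurableT fi gi).
Qed.

Lemma has_integralZ f v c : has_integral f v ->
  has_integral (fun x => c * f x) (c * v).
Proof.
move=> [fi <-]; split; last by rewrite RintegralZl.
exact: (integrableZl measurableT c fi).
Qed.

Lemma has_integral_sum (T : finType) (f : T -> R -> R) (v : T -> R) :
  (forall z, has_integral (f z) (v z)) ->
  has_integral (fun x => \sum_z f z x) (\sum_z v z).
Proof.
move=> fv; elim: (index_enum T) => [|z s IH].
  under eq_fun do rewrite big_nil; rewrite big_nil; split.
    exact: integrable0.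
  by rewrite Rintegral_cst// mul0r.
under eq_fun do rewrite big_cons; rewrite big_cons.
exact: has_integralD.
Qed.

Lemma has_integral_le f g u v : has_integral f u -> has_integral g v ->
  (forall x, f x <= g x) -> u <= v.
Proof. by move=> [fi <-] [gi <-] fg; apply: le_Rintegral. Qed.

Lemma has_integral_normal (t sigma : R) :
  has_integral (normal_pdf t sigma) 1.
Proof.
split; first exact: integrable_normal_pdf.
by rewrite /Rintegral integral_normal_pdf.
Qed.

(** Completing the square: the tilted density is a constant times the normal density with mean
    shifted by [s * sigma ^+ 2]. *)
Lemma has_integral_normal_tilt (t sigma s c : R) : sigma != 0 ->
  has_integral (fun x => normal_pdf t sigma x * expR (s * (x - c)))
    (expR (s * (t - c) + s ^+ 2 * sigma ^+ 2 / 2)).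
Proof.
move=> s0.
rewrite -[X in has_integral _ X]mulr1.
have := has_integralZ (expR (s * (t - c) + s ^+ 2 * sigma ^+ 2 / 2))
  (has_integral_normal (t + s * sigma ^+ 2) sigma).
congr has_integral; apply/funext => x; rewrite !normal_pdfE// /normal_fun.
rewrite mulrCA -[RHS]mulrA; congr (_ * _).
by rewrite -!expRD; congr expR; field.
Qed.

Lemma has_integral_channel (k : R -> R) (t sigma : R) :
  measurable_fun setT k -> (forall x, 0 <= k x <= 1) ->
  has_integral (fun x => k x * normal_pdf t sigma x)
    (\int[mu]_x (k x * normal_pdf t sigma x)).
Proof.
move=> mk k01; split => //.
apply: (le_integrable measurableT _ _ (integrable_normal_pdf t sigma)).
  apply/measurable_EFinP; apply: measurable_funM => //.
  exact: measurable_normal_pdf.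
move=> x _ /=; rewrite lee_fin !ger0_norm ?normal_pdf_ge0//.
  have /andP[_ k1] := k01 x; have := normal_pdf_ge0 t sigma x => n0.
  by rewrite -[leRHS]mul1r ler_wpM2r.
by rewrite mulr_ge0 ?normal_pdf_ge0//; have /andP[] := k01 x.
Qed.

End has_integral.

Section pointwise.
Context {R : realType}.

Lemma cosh_mono (a b : R) : `|a| <= `|b| ->
  expR a + expR (- a) <= expR b + expR (- b).
Proof.
have e (x : R) : expR x + expR (- x) = expR `|x| + expR (- `|x|).
  by case: (ger0P x) => x0 //; rewrite opprK addrC.
rewrite (e a) (e b); move: `|a| `|b| (normr_ge0 a) => {a}a {}b a0 ab.
have h1 := expR_gt0 a; have h2 := expR_gt0 b.
have h3 := expRxMexpNx_1 a; have h4 := expRxMexpNx_1 b.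
have h5 : expR a <= expR b by rewrite ler_expR.
have h6 : expR (- b) <= 1 by rewrite expR_le1; lra.
have h7 : expR (- a) <= 1 by rewrite expR_le1; lra.
have := expR_gt0 (- a); have := expR_gt0 (- b) => h8 h9.
have -> : expR (- a) = expR (- b) + (expR b - expR a) * (expR (- a) * expR (- b)).
  rewrite mulrBl [X in _ + (X - _)]mulrCA h4 mulrA h3; ring.
have : expR (- a) * expR (- b) <= 1 by rewrite mulr_ile1// ltW.
have : 0 <= expR b - expR a by lra.
nra.
Qed.

(** For [y >= 0], [expR y - 1 <= y * expR y] and [1 - expR (- y) <= y] bound the numerator. *)
Lemma tanh_le (y : R) :
  `|(expR y - expR (- y)) / (expR y + expR (- y))| <= 2 * `|y|.
Proof.
wlog y0 : y / 0 <= y => [H|].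
  have [/H//|/ltW y0] := leP 0 y.
  have := H (- y); rewrite opprK normrN => /(_ ltac:(lra)).
  by rewrite -opprB mulNr normrN [expR (-y) + _]addrC.
have h1 := expR_ge1Dx (- y); have h2 := expRxMexpNx_1 y.
have h3 := expR_gt0 y; have h4 := expR_gt0 (- y).
have h5 : expR (- y) <= expR y by rewrite ler_expR; lra.
rewrite !ger0_norm//; last by rewrite divr_ge0//; lra.
rewrite ler_pdivrMr; last by lra.
have : expR y - 1 <= expR y * y by nra.
have : 1 - expR (- y) <= y by lra.
have : 1 <= expR y by rewrite -expR0 ler_expR.
nra.
Qed.

(* [a] and [b] are the two Gaussian densities, [y] half their log-ratio, so that
   the contrast [(b - a) / (a + b)] is [tanh y]. *)
Lemma tilt_pointwise (w y l a b : R) : 0 < w ->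
  a = w * expR (- y) -> b = w * expR y ->
  (a + b) / 2 * expR (l * ((b - a) / (a + b))) <=
  l * ((b - a) / 2) +
  (a + b) / 2 * ((expR (4 * l * y) + expR (- (4 * l * y))) / 2).
Proof.
move=> w0 aE bE.
have a0 : 0 < a by rewrite aE mulr_gt0 ?expR_gt0.
have b0 : 0 < b by rewrite bE mulr_gt0 ?expR_gt0.
set g := (b - a) / (a + b).
have gy : `|g| <= 2 * `|y|.
  apply: le_trans (tanh_le y); rewrite le_eqVlt; apply/orP; left; apply/eqP.
  congr `|_|; rewrite /g aE bE -mulrBr -mulrDr addrC invfM mulrACA.
  by rewrite divff ?mul1r ?[expR (- y) + _]addrC//; apply: lt0r_neq0.
have -> : l * ((b - a) / 2) = (a + b) / 2 * (l * g).
  by rewrite /g; field; apply: lt0r_neq0; lra.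
clearbody g; rewrite -mulrDr; apply: ler_wpM2l; first lra.
apply: (le_trans (expR_le_cosh2 _)); rewrite lerD2l ler_wpM2r//.
apply: cosh_mono; rewrite !normrM !normr_nat.
have := normr_ge0 l; have := ler_wpM2l (normr_ge0 l) gy.
lra.
Qed.

(** Jensen's inequality before integration. The left side is the tangent, along [n = r * M], to the
    convex function [M * expR (l * (n / M))]; being linear in [M] and [n], it can be integrated
    against the channel without conditional expectations. *)
Lemma tangent_expR (M n l r : R) : 0 < M ->
  expR (l * r) * (M + l * (n - r * M)) <= M * expR (l * (n / M)).
Proof.
move=> M0.
have -> : M + l * (n - r * M) = M * (1 + (l * (n / M) - l * r)).
  by field; exact: lt0r_neq0.
rewrite mulrCA; apply: ler_wpM2l; first exact: ltW.
have -> : expR (l * (n / M)) = expR (l * r) * expR (l * (n / M) - l * r).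
  by rewrite -expRD; congr expR; ring.
by rewrite ler_wpM2l ?expR_ge0// expR_ge1Dx.
Qed.

End pointwise.

Section gaussian_channel.
Context {R : realType} {T : finType}.
Variables (k : T -> R -> R) (sigma : R).
Hypotheses (sigma0 : 0 < sigma) (mk : forall z, measurable_fun setT (k z))
  (k0 : forall z x, 0 <= k z x) (k1 : forall x, \sum_z k z x = 1).
Local Notation mu := lebesgue_measure.

Definition channel_law (t : R) (z : T) : R :=
  \int[mu]_x (k z x * normal_pdf t sigma x).

Let k01 z x : 0 <= k z x <= 1.
Proof.
by rewrite k0 -(k1 x) (bigD1 z)//= lerDl; exact: sumr_ge0.
Qed.

Let channelI t z : has_integral (fun x => k z x * normal_pdf t sigma x)
  (channel_law t z).
Proof. exact: has_integral_channel. Qed.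

Lemma channel_law_pmf t : pmf_on (channel_law t).
Proof.
split=> [z|].
  by apply: Rintegral_ge0 => x _; rewrite mulr_ge0 ?normal_pdf_ge0.
have [_ <-] := has_integral_sum (channelI t).
have [_ <-] := has_integral_normal t sigma.
by apply: eq_Rintegral => x _; rewrite -mulr_suml k1 mul1r.
Qed.

(** For each message the tangent taken at its contrast integrates exactly to the corresponding term.
    Summed over messages, the tangents lie below a function of the observation alone, which
    [tilt_pointwise] bounds by Gaussian exponential moments. *)
Lemma channel_law_subgaussian (t t' : R) : ((t' - t) / sigma) ^+ 2 <= 4 ->
  subgaussian_contrast (10 * ((t' - t) / sigma) ^+ 2)
    (channel_law t) (channel_law t').
Proof.
move=> rho4 l.
set p := channel_law t; set q := channel_law t'.
pose phi := normal_pdf t sigma; pose phi' := normal_pdf t' sigma.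
(* At [c] the two densities agree, and [s] makes [s * (x - c)] equal to [4 * l * y] for [y] half the
   log-likelihood ratio. *)
pose c := (t + t') / 2; pose s := 2 * l * (t' - t) / sigma ^+ 2.
have sn0 : sigma != 0 by exact: lt0r_neq0.
pose r := contrast p q.
pose F z x := expR (l * r z) *
  (((1 - l * r z - l) / 2) * (k z x * phi x) + ((1 - l * r z + l) / 2) * (k z x * phi' x)).
have FI z : has_integral (F z) (midpoint p q z * expR (l * r z)).
  have -> : midpoint p q z * expR (l * r z) = expR (l * r z) *
    (((1 - l * r z - l) / 2) * p z + ((1 - l * r z + l) / 2) * q z).
    have p0 := (channel_law_pmf t).1 z; have q0 := (channel_law_pmf t').1 z.
    rewrite mulrC; congr (_ * _); rewrite /midpoint /r /contrast.
    have [pq0|pq0] := eqVneq (p z + q z) 0.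
      have [-> ->] : p z = 0 /\ q z = 0 by rewrite /p /q in pq0 *; split; lra.
      by rewrite !mulr0 addr0 mul0r.
    by field.
  apply: has_integralZ; apply: has_integralD; exact/has_integralZ/channelI.
pose tilt (th e : R) x := normal_pdf th sigma x * expR (e * s * (x - c)).
(* The bound of [tilt_pointwise], integrated: the terms in [l / 2] cancel, and each density is
   tilted in both directions. *)
have GI : has_integral (fun x => l / 2 * phi' x + - (l / 2) * phi x +
   (1 / 4 * tilt t 1 x + 1 / 4 * tilt t (- 1) x +
   (1 / 4 * tilt t' 1 x + 1 / 4 * tilt t' (- 1) x)))
  (l / 2 * 1 + - (l / 2) * 1 + (1 / 4 * expR (1 * s * (t - c) + (1 * s) ^+ 2 * sigma ^+ 2 / 2) +
     1 / 4 * expR (- 1 * s * (t - c) + (- 1 * s) ^+ 2 * sigma ^+ 2 / 2) +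
   (1 / 4 * expR (1 * s * (t' - c) + (1 * s) ^+ 2 * sigma ^+ 2 / 2) +
     1 / 4 * expR (- 1 * s * (t' - c) + (- 1 * s) ^+ 2 * sigma ^+ 2 / 2)))).
  have hn th : has_integral (normal_pdf th sigma) 1 := has_integral_normal th sigma.
  have ht th e := has_integral_normal_tilt th (e * s) c sn0.
  by apply: has_integralD; apply: has_integralD; try apply: has_integralD;
    apply: has_integralZ; [exact: hn|exact: hn|exact: ht..].
apply: (le_trans (has_integral_le (has_integral_sum FI) GI _)) => [x|].
  pose y := (t' - t) * (x - c) / (2 * sigma ^+ 2).
  have sy : s * (x - c) = 4 * l * y by rewrite /s /y; field.
  have phi0 : 0 < phi x.
    by rewrite /phi normal_pdfE// mulr_gt0 ?normal_peak_gt0// /normal_fun expR_gt0.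
  have phiE : phi x = phi x * expR y * expR (- y).
    by rewrite -mulrA expRxMexpNx_1 mulr1.
  have phi'E : phi' x = phi x * expR y * expR y.
    rewrite /phi /phi' !normal_pdfE// /normal_fun -!mulrA -!expRD.
    by congr (_ * expR _); rewrite /y /c; field.
  have w0 : 0 < phi x * expR y by rewrite mulr_gt0 ?expR_gt0.
  have phi'0 : 0 < phi' x by rewrite phi'E mulr_gt0 ?expR_gt0.
  pose M := (phi x + phi' x) / 2; pose n := (phi' x - phi x) / 2.
  have M0 : 0 < M by rewrite /M; lra.
  apply: (@le_trans _ _ (M * expR (l * (n / M)))).
    rewrite -[leRHS]mul1r -(k1 x) mulr_suml; apply: ler_sum => z _.
    have -> : F z x = k z x * (expR (l * r z) * (M + l * (n - r z * M))).
      by rewrite /F /M /n; field.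
    by rewrite ler_wpM2l ?k0// tangent_expR.
  have := tilt_pointwise l w0 phiE phi'E.
  have -> : n / M = (phi' x - phi x) / (phi x + phi' x).
    by rewrite /n /M; field; apply: lt0r_neq0; lra.
  move=> /le_trans; apply; rewrite le_eqVlt; apply/orP; left; apply/eqP.
  have sy' : - 1 * s * (x - c) = - (4 * l * y) by rewrite mulN1r mulNr sy.
  rewrite /tilt (mul1r s) sy sy' -/(phi x) -/(phi' x).
  by field.
have tc : t - c = - ((t' - t) / 2) by rewrite /c; field.
have t'c : t' - c = (t' - t) / 2 by rewrite /c; field.
rewrite tc t'c (mul1r s) (mulN1r s) sqrrN.
set rho := (t' - t) / sigma.
have e1 : s ^+ 2 * sigma ^+ 2 / 2 = 2 * (l ^+ 2 * rho ^+ 2).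
  by rewrite /s /rho; field.
pose v := l * rho ^+ 2.
have e2 : s * ((t' - t) / 2) = v by rewrite /v /rho /s; field.
rewrite e1 mulrNN mulNr mulrN e2.
have -> : l / 2 * 1 + - (l / 2) * 1 +
  (1 / 4 * expR (- v + 2 * (l ^+ 2 * rho ^+ 2)) + 1 / 4 * expR (v + 2 * (l ^+ 2 * rho ^+ 2)) +
   (1 / 4 * expR (v + 2 * (l ^+ 2 * rho ^+ 2)) + 1 / 4 * expR (- v + 2 * (l ^+ 2 * rho ^+ 2)))) =
  (expR v + expR (- v)) / 2 * expR (2 * (l ^+ 2 * rho ^+ 2)).
  by rewrite !expRD; field.
(* The factor [10] is [2], from the variance in the tilt, plus [8], from [2 * v ^+ 2] with
   [rho ^+ 2 <= 4]. *)
have := cosh_le v; rewrite mulrC -ler_pdivrMr// => h.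
apply: (le_trans (ler_wpM2r (expR_ge0 _) h)).
rewrite -expRD ler_expR /v exprMn.
have : 0 <= l ^+ 2 * rho ^+ 2 * (4 - rho ^+ 2).
  by apply: mulr_ge0; [rewrite mulr_ge0 ?sqr_ge0|rewrite subr_ge0].
lra.
Qed.

End gaussian_channel.

(** * Samplings and the law of the transcript *)

Section product_space.

(** The casts vanish since equality proofs between ordinals are unique; the existential form keeps
    them out of later proofs. *)
Lemma dependent_cons n (F : 'I_n.+1 -> Type) (y0 : F ord0)
    (y : forall j, F (lift ord0 j)) :
  exists f : forall i, F i, f ord0 = y0 /\ forall j, f (lift ord0 j) = y j.
Proof.
pose f i : F i := match unliftP ord0 i with
  | UnliftSome j e => ecast k (F k) (esym e) (y j)
  | UnliftNone e => ecast k (F k) (esym e) y0 end.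
exists f; split=> [|j]; rewrite /f.
  case: unliftP => [j e|e].
    by exfalso; move/eqP: e; rewrite (negbTE (neq_lift _ _)).
  by rewrite eq_axiomK.
case: unliftP => [j' e|e].
  have jj := lift_inj e; subst j'.
  by rewrite eq_axiomK.
by exfalso; move/eqP: e; rewrite eq_sym (negbTE (neq_lift _ _)).
Qed.

Definition mfun_of d d' (aT : measurableType d) (rT : measurableType d')
    (f : aT -> rT) (mf : measurable_fun setT f) : {mfun aT >-> rT} :=
  mfun_Sub (mem_set mf).

(** Induction on [m], splitting off the first coordinate by a binary product; the base case is a
    one-point space. *)
Lemma product_space (R : realType) m (d : 'I_m -> measure_display)
    (T : forall i, measurableType (d i)) (P : forall i, probability (T i) R) :
  exists (d0 : measure_display) (S : measurableType d0) (Q : probability S R)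
    (X : forall i, {mfun S >-> T i}),
    (forall A : forall i, set (T i), (forall i, measurable (A i)) ->
      Q (\bigcap_i (X i @^-1` A i)) = (\prod_(i < m) P i (A i))%E) /\
    (forall i A, measurable A -> Q (X i @^-1` A) = P i A).
Proof.
elim: m d T P => [|m IH] d T P.
  exists _, unit, (dirac tt).
  have X i : {mfun unit >-> T i} by case: i => [[]].
  exists X; split=> [A mA|[[]]//].
  rewrite big_ord0 (_ : \bigcap_i _ = setT) ?probability_setT//.
  by apply/seteqP; split => // -[] _ [[]].
have [d0 [S [Q [X [XA XP]]]]] := IH _ _ (fun j => P (lift ord0 j)).
pose Q' : probability (T ord0 * S)%type R := (P ord0 \x Q)%E.
pose Y0 := mfun_of (@measurable_fst _ _ (T ord0) S).
have mY j : measurable_fun setT (X j \o @snd (T ord0) S).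
  exact: measurableT_comp.
have [Z [Z0 ZS]] := @dependent_cons m (fun i => {mfun (T ord0 * S)%type >-> T i})
  Y0 (fun j => mfun_of (mY j)).
exists _, _, Q', Z; split=> [A mA|i A mA].
  rewrite big_ord_recl -XA// -product_measure1E//; last first.
    apply: fin_bigcap_measurable => // i _.
    by rewrite -[X in measurable X]setTI; exact: measurable_funP.
  congr (Q' _); apply/seteqP; split => [[a b] /= h|[a b] /= [h1 h2] i _ /=].
    split; first by have := h ord0 I; rewrite /= Z0.
    by move=> j _ /=; have := h (lift ord0 j) I; rewrite /= ZS.
  by case: (unliftP ord0 i) => [j ->|->]; [rewrite ZS; exact: h2|rewrite Z0].
case: (unliftP ord0 i) A mA => [j ->|->] A mA.
  rewrite ZS -XP//.
  rewrite (_ : _ @^-1` A = setT `*` (X j @^-1` A)).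
    rewrite /Q' /= product_measure1E//.
      by rewrite [X in (X * _)%E](_ : _ = 1%E) ?mul1e//; exact: probability_setT.
    by rewrite -[X in measurable X]setTI; exact: measurable_funP.
  by apply/seteqP; split => -[a b] //= [].
rewrite Z0 (_ : _ @^-1` A = A `*` setT).
  rewrite /Q' /= product_measure1E//.
  by rewrite [X in (_ * X)%E](_ : _ = 1%E) ?mule1//; exact: probability_setT.
by apply/seteqP; split => -[a b] //= [].
Qed.

End product_space.

(** * Integration against the normal law *)

Section normal_integral.
Context {R : realType}.

(** The Radon-Nikodym derivative of the normal law has the same integrals as [normal_pdf], hence
    equals it almost everywhere. *)
Lemma integral_normal_prob (t sigma : R) (f : R -> \bar R) :
  measurable_fun setT f -> (forall x, (0 <= f x)%E) ->
  (\int[normal_prob t sigma]_x f x =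
   \int[lebesgue_measure]_x (f x * (normal_pdf t sigma x)%:E))%E.
Proof.
move=> mf f0.
have dom := normal_prob_dominates t sigma.
rewrite -(Radon_Nikodym_SigmaFinite.change_of_variables dom)//.
apply: ae_eq_integral => //.
- apply: emeasurable_funM => //.
  exact: measurable_int (Radon_Nikodym_SigmaFinite.f_integrable _).
- apply: emeasurable_funM => //; apply/measurable_EFinP.
  exact: measurable_normal_pdf.
- apply: ae_eqe_mul2l; apply: integral_ae_eq => //.
  + exact: Radon_Nikodym_SigmaFinite.f_integrable.
  + by apply/measurable_EFinP; exact: measurable_normal_pdf.
  + by move=> E _ mE; rewrite -Radon_Nikodym_SigmaFinite.f_integral.
Qed.

(* The library's normal law lives on [measurableTypeR R], whose display differs
   from that of the canonical structure on [R]; [normal_law] transports it. *)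
Lemma measurable_borel_id : measurable_fun [set: measurableTypeR R] (idfun : measurableTypeR R -> R).
Proof. exact: measurable_id. Qed.

Definition normal_law (t sigma : R) : probability R R :=
  distribution (normal_prob t sigma) (mfun_of measurable_borel_id).

Lemma integral_normal_law (t sigma : R) (f : R -> \bar R) :
  measurable_fun setT f -> (forall x, (0 <= f x)%E) ->
  (\int[normal_law t sigma]_x f x =
   \int[lebesgue_measure]_x (f x * (normal_pdf t sigma x)%:E))%E.
Proof.
move=> mf f0; rewrite ge0_integral_distribution//.
exact: integral_normal_prob.
Qed.

End normal_integral.

(** * Messages as outputs of channels *)

Section transcript_law.
Context {R : realType} {m : nat} {b : 'I_m -> nat}.
Variables (p : protocol R b) (sigma : R).
Local Notation transcripts := (fprod (fun i => (b i).-tuple bool : finType)).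

Lemma measurable_tuple_set1 n (z : n.-tuple bool) : measurable [set z].
Proof.
rewrite (_ : [set z] = \bigcap_(i in [set: 'I_n]) ((@tnth n bool)^~ i @^-1` [set tnth z i])).
  apply: fin_bigcap_measurable => // i _; rewrite -[X in measurable X]setTI.
  exact: measurable_tnth.
apply/seteqP; split=> [y -> //|y h].
by apply/eq_from_tnth => i; exact: h.
Qed.

Definition observation_law (theta : R) i : probability (R * seed_space p i)%type R :=
  (normal_law theta sigma \x seed_law p i)%E.

Definition message_law (theta : R) i (z : (b i).-tuple bool) : R :=
  fine (observation_law theta i (encoder p i @^-1` [set z])).

Lemma measurable_encoder_fiber i (z : (b i).-tuple bool) :
  measurable (encoder p i @^-1` [set z]).
Proof.
rewrite -[X in measurable X]setTI; apply: measurable_funP => //.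
exact: measurable_tuple_set1.
Qed.

(** The supremum in [worst_case_risk] runs over samplings, so a lower bound requires one to exist.
    It is built as the product of the machines' (observation, seed) pairs and the estimator's seed;
    Tonelli's theorem then integrates out the data first. *)
Lemma sampling_with_risk (theta : R) : exists S : sampling sigma theta p,
  mean_squared_error S = (\int[est_seed_law p]_u
    (\sum_(z : transcripts) joint (message_law theta) z *
       (estimator p z u - theta) ^+ 2)%:E)%E.
Proof.
have [d [S [Q [X [XA XP]]]]] := product_space (observation_law theta).
pose E := est_seed_space p.
pose Pr : probability (S * E)%type R := (Q \x est_seed_law p)%E.
have mobs i : measurable_fun setT (fst \o X i \o @fst S E).
  by do 2 apply: measurableT_comp => //.
have mseed i : measurable_fun setT (snd \o X i \o @fst S E).
  by do 2 apply: measurableT_comp => //.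
pose obs i : {RV Pr >-> R} := mfun_of (mobs i).
pose seed i : {RV Pr >-> seed_space p i} := mfun_of (mseed i).
pose est : {RV Pr >-> E} := mfun_of (@measurable_snd _ _ S E).
have rect (U : set S) (D : set E) : measurable U -> measurable D ->
    Pr (U `*` D) = (Q U * est_seed_law p D)%E.
  by move=> mU mD; rewrite /Pr /= product_measure1E.
have mX i (A : set (R * seed_space p i)) : measurable A -> measurable (X i @^-1` A).
  by move=> mA; rewrite -[X in measurable X]setTI; exact: measurable_funP.
have law i (A : set R) (C : set (seed_space p i)) : measurable A -> measurable C ->
    observation_law theta i (A `*` C) =
    (normal_prob theta sigma A * seed_law p i C)%E.
  by move=> mA mC; rewrite /observation_law /= product_measure1E.
have obsE i A : measurable A -> Pr (obs i @^-1` A) = normal_prob theta sigma A.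
  move=> mA; have mAT : measurable (A `*` [set: seed_space p i]) by exact: measurableX.
  transitivity (Pr ((X i @^-1` (A `*` setT)) `*` setT)).
    by congr (Pr _); apply/seteqP; split => -[x y] //= [[]].
  rewrite rect//; last exact: mX.
  by rewrite XP// law// !probability_setT !mule1.
have seedE i A : measurable A -> Pr (seed i @^-1` A) = seed_law p i A.
  move=> mA; have mAT : measurable ([set: R] `*` A) by exact: measurableX.
  transitivity (Pr ((X i @^-1` (setT `*` A)) `*` setT)).
    by congr (Pr _); apply/seteqP; split => -[x y] //= [[]].
  rewrite rect//; last exact: mX.
  by rewrite XP// law// !probability_setT mule1 mul1e.
have estE A : measurable A -> Pr (est @^-1` A) = est_seed_law p A.
  move=> mA; transitivity (Pr (setT `*` A)).
    by congr (Pr _); apply/seteqP; split => -[x y] //= [].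
  by rewrite rect// probability_setT mul1e.
have ind (A : 'I_m -> set R) (C : forall i, set (seed_space p i)) (D : set E) :
    (forall i, measurable (A i)) -> (forall i, measurable (C i)) -> measurable D ->
    Pr ((\bigcap_i (obs i @^-1` A i `&` seed i @^-1` C i)) `&` est @^-1` D) =
    ((\prod_(i < m) (Pr (obs i @^-1` A i) * Pr (seed i @^-1` C i)))
      * Pr (est @^-1` D))%E.
  move=> mA mC mD.
  have mAC i : measurable (A i `*` C i) by exact: measurableX.
  transitivity (Pr ((\bigcap_i (X i @^-1` (A i `*` C i))) `*` D)).
    by [].
  rewrite rect//; last by apply: fin_bigcap_measurable => // i _; exact: mX.
  rewrite XA// estE//; congr (_ * _)%E; apply: eq_bigr => i _.
  by rewrite obsE// seedE// law.
exists (Sampling obsE seedE estE ind).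
rewrite /mean_squared_error unlock /=.
pose Y (x : S) : transcripts := fprod_of_fun (fun i => encoder p i (X i x)).
have fiberY (z : transcripts) :
    [set x | Y x = z] = \bigcap_i (X i @^-1` (encoder p i @^-1` [set z i])).
  apply/seteqP; split=> [x /= <- i _ /=|x h /=]; first by rewrite fprodE.
  by apply/fprodP => i; rewrite fprodE; exact: h.
have mY z : measurable [set x | Y x = z].
  rewrite fiberY; apply: fin_bigcap_measurable => // i _.
  by apply: mX; exact: measurable_encoder_fiber.
have QY z : Q [set x | Y x = z] = (joint (message_law theta) z)%:E.
  rewrite fiberY XA; last by move=> i; exact: measurable_encoder_fiber.
  rewrite /joint -prodEFin; apply: eq_bigr => i _.
  rewrite fineK// fin_num_measure//; exact: measurable_encoder_fiber.
pose g z (u : E) := (estimator p z u - theta) ^+ 2.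
have mg z : measurable_fun setT (g z).
  by apply: measurable_funX; apply: measurable_funB.
(* Splitting by the value of the transcript turns the squared error into a finite sum of products of
   a function of the data and one of the estimator's seed. *)
pose f (w : S * E) := (\sum_(z : transcripts) (\1_[set x | Y x = z] w.1 * g z w.2)%:E)%E.
rewrite (_ : (fun w => _) = f); last first.
  apply/funext => -[x u]; rewrite /f (bigD1 (Y x))//= big1 ?adde0.
    rewrite indicE mem_set//= mul1r /g /estimate /transcript /=.
    do 3 f_equal; congr (estimator p _ u); apply: functional_extensionality_dep => i.
    by rewrite fprodE; case: (X i x).
  by move=> z zY; rewrite indicE memNset ?mul0r//= => /esym/eqP; rewrite (negbTE zY).
have mterm z : measurable_fun setT (fun w : S * E => (\1_[set x | Y x = z] w.1 * g z w.2)%:E).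
  apply/measurable_EFinP; apply: measurable_funM; last exact: measurableT_comp.
  by apply: (measurableT_comp (measurable_indic (mY z))).
have f0 w : (0 <= f w)%E.
  by apply: sume_ge0 => z _; rewrite lee_fin mulr_ge0// sqr_ge0.
rewrite fubini_tonelli2//; last exact: emeasurable_sum.
apply: eq_integral => u _; rewrite /fubini_G /f /= ge0_integral_sum//.
- rewrite -sumEFin; apply: eq_bigr => z _.
  under eq_integral do rewrite EFinM.
  rewrite ge0_integralZr ?lee_fin ?sqr_ge0//.
    by rewrite integral_indic// setIT [X in (X * _)%E](QY z) -EFinM.
  by apply/measurable_EFinP/measurable_indic.
- by move=> z; apply/measurable_EFinP/measurable_funM => //; exact: measurable_indic.
- by move=> z x _; rewrite lee_fin mulr_ge0// sqr_ge0.
Qed.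

(** The supremum dominates the average over finitely many parameters, and at each fixed seed the
    estimator is a deterministic [t]. *)
Lemma worst_case_risk_ge (J : finType) (theta : J -> R) (a : R) :
  (0 < #|J|)%N -> 0 <= a -> (forall j, 0 <= theta j <= 1) ->
  (forall t : transcripts -> R, #|J|%:R * a <=
    \sum_j \sum_z joint (message_law (theta j)) z * (t z - theta j) ^+ 2) ->
  (a%:E <= worst_case_risk sigma p)%E.
Proof.
move=> J0 a0 theta01 ge_a.
pose F j u := \sum_(z : transcripts) joint (message_law (theta j)) z *
  (estimator p z u - theta j) ^+ 2.
have msg0 th z : 0 <= joint (message_law th) z.
  by apply: prodr_ge0 => i _; apply: fine_ge0.
have F0 j u : 0 <= F j u.
  by apply: sumr_ge0 => z _; rewrite mulr_ge0 ?sqr_ge0.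
have mF j : measurable_fun setT (F j).
  apply: measurable_sum => z; apply: measurable_funM => //.
  by apply: measurable_funX; apply: measurable_funB.
have Fle j : (\int[est_seed_law p]_u (F j u)%:E <= worst_case_risk sigma p)%E.
  have [S <-] := sampling_with_risk (theta j).
  by apply: ereal_sup_ubound; exists (theta j) => //; exists S.
have : ((#|J|%:R * a)%:E <= \sum_(j in J) worst_case_risk sigma p)%E.
  apply: (@le_trans _ _ (\sum_(j in J) \int[est_seed_law p]_u (F j u)%:E)%E); last exact: lee_sum.
  rewrite -ge0_integral_sum//; last 2 first.
  - by move=> j; apply/measurable_EFinP.
  - by move=> j u _; rewrite lee_fin.
  apply: (@le_trans _ _ (\int[est_seed_law p]_u (#|J|%:R * a)%:E)%E).
    by rewrite integral_cst// [X in (_ * X)%E](probability_setT (est_seed_law p)) mule1.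
  apply: ge0_le_integral => //.
  - by move=> u _; rewrite lee_fin mulr_ge0.
  - by apply: emeasurable_sum => j; apply/measurable_EFinP.
  - by move=> u _; rewrite sumEFin lee_fin; exact: ge_a.
have [j _] : exists j : J, j \in J by apply/card_gt0P.
(* Excludes the value [-oo] in the case analysis; for [+oo] the claim is immediate. *)
have : (0 <= worst_case_risk sigma p)%E.
  by apply: le_trans (Fle j); apply: integral_ge0 => u _; rewrite lee_fin.
case: (worst_case_risk sigma p) => [r _| _ _|//]; last by rewrite leey.
by rewrite sumEFin !lee_fin sumr_const -(mulr_natl r) ler_pM2l// ltr0n.
Qed.

(** Averaging over the private seed makes the encoder a channel: the conditional probability of
    message [z] given the observation [x]. *)
Definition seed_kernel i (z : (b i).-tuple bool) (x : R) : R :=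
  fine (seed_law p i (xsection (encoder p i @^-1` [set z]) x)).

Lemma measurable_seed_kernel i z : measurable_fun setT (@seed_kernel i z).
Proof.
apply: measurableT_comp => //.
exact: (measurable_fun_xsection _ (measurable_encoder_fiber z)).
Qed.

Lemma seed_kernel_ge0 i z x : 0 <= @seed_kernel i z x.
Proof. exact: fine_ge0. Qed.

Lemma sum_seed_kernel i x : \sum_z @seed_kernel i z x = 1.
Proof.
apply: EFin_inj; rewrite -sumEFin.
pose f u := encoder p i (x, u).
have mf z : measurable (f @^-1` [set z]).
  have := measurable_xsection x (measurable_encoder_fiber z).
  by rewrite xsectionE.
transitivity (\sum_(z : (b i).-tuple bool) \int[seed_law p i]_u (\1_(f @^-1` [set z]) u)%:E)%E.
  apply: eq_bigr => z _; rewrite integral_indic// setIT fineK ?xsectionE//.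
  exact: (fin_num_measure _ _ (mf z)).
rewrite -(@ge0_integral_sum _ _ _ (seed_law p i) setT measurableT _
  (fun z u => (\1_(f @^-1` [set z]) u)%:E)).
- transitivity (\int[seed_law p i]_u 1)%E; last first.
    by rewrite integral_cst// [X in (_ * X)%E](probability_setT (seed_law p i)) mule1.
  apply: eq_integral => u _; rewrite (bigD1 (f u))//= big1 ?adde0.
    by rewrite indicE mem_set.
  by move=> z zf; rewrite indicE memNset//= => /esym/eqP; rewrite (negbTE zf).
- by move=> z; apply/measurable_EFinP/measurable_indic.
- by move=> z u _; rewrite lee_fin.
Qed.

Lemma message_law_channel theta i :
  @message_law theta i = channel_law (@seed_kernel i) sigma theta.
Proof.
apply/funext => z; rewrite /message_law /channel_law /Rintegral; congr fine.
rewrite /observation_law /= /product_measure1 integral_normal_law//.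
- apply: eq_integral => x _ /=; rewrite EFinM fineK//.
  exact: (fin_num_measure _ _ (measurable_xsection x (measurable_encoder_fiber z))).
- exact: (measurable_fun_xsection _ (measurable_encoder_fiber z)).
Qed.

End transcript_law.

Arguments message_law {R m b} p sigma theta i z.

(** * Lower bounds on the worst-case risk *)

Section risk_bounds.
Context {R : realType} {m : nat} {b : 'I_m -> nat}.
Variables (p : protocol R b) (sigma : R).
Hypothesis sigma0 : 0 < sigma.
Local Notation transcripts := (fprod (fun i => (b i).-tuple bool : finType)).
Local Notation B := (\sum_(i < m) b i)%N.
Local Notation P := (message_law p sigma).

Lemma message_law_pmf theta i : pmf_on (P theta i).
Proof.
rewrite message_law_channel; apply: channel_law_pmf.
- exact: measurable_seed_kernel.
- exact: seed_kernel_ge0.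
- exact: sum_seed_kernel.
Qed.

Lemma message_law_subgaussian theta theta' i :
  ((theta' - theta) / sigma) ^+ 2 <= 4 ->
  subgaussian_contrast (10 * ((theta' - theta) / sigma) ^+ 2)
    (P theta i) (P theta' i).
Proof.
move=> h; rewrite !message_law_channel; apply: channel_law_subgaussian => //.
- exact: measurable_seed_kernel.
- exact: seed_kernel_ge0.
- exact: sum_seed_kernel.
Qed.

Lemma ln_card_transcripts : ln #|{: transcripts}|%:R = B%:R * ln 2 :> R.
Proof.
rewrite card_fprod (eq_bigr (fun i => 2 ^ b i)%N); last first.
  by move=> i _; rewrite card_tuple card_bool.
by rewrite -expn_sum natrX lnXn// mulr_natl.
Qed.

Lemma quantization_bound :
  ((32 ^- 2 * 2 `^ (- (2 * B%:R)))%:E <= worst_case_risk sigma p)%E.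
Proof.
(* Five bits beyond the budget turn the constant of [grid_entropy] into [- 2 * ln 2 <= - 1], so the
   mean squared error in units of the spacing [1 / K] is at least [1]. *)
pose K := (2 ^ (B + 5))%N.
have K0 : (0 < K)%N by rewrite expn_gt0.
have KR : 0 < K%:R :> R by rewrite ltr0n.
have KE : K%:R = 2 ^+ B * 32 :> R by rewrite /K natrX exprD; congr (_ * _); ring.
rewrite (_ : _ * _ = (K%:R ^+ 2)^-1); last first.
  have -> : 2 * B%:R = (B * 2)%:R :> R by rewrite natrM mulrC.
  rewrite powRN powR_mulrn// exprM KE; field.
  exact/lt0r_neq0/exprn_gt0.
apply: (@worst_case_risk_ge _ _ _ _ _ _ (fun k : 'I_K => k%:R / K%:R)).
- by rewrite card_ord.
- by rewrite invr_ge0 sqr_ge0.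
- move=> k; rewrite divr_ge0//= ler_pdivrMr// mul1r ler_nat; exact: ltnW.
move=> t; rewrite card_ord.
have pmfP (k : 'I_K) : pmf_on (joint (P (k%:R / K%:R))).
  by apply: joint_pmf => i; exact: message_law_pmf.
have := grid_entropy (fun z => K%:R * t z) K0 pmfP.
have : 0 <= \sum_(k < K) entropy (joint (P (k%:R / K%:R))).
  by apply: sumr_ge0 => k _; exact: entropy_ge0.
have lnK : ln K%:R = (B%:R + 5) * ln 2 :> R.
  by rewrite /K natrX lnXn// -(mulr_natl (ln 2)) natrD.
rewrite ln_card_transcripts lnK; clearbody K.
set S := \sum_k \sum_z _ => h0 h1.
have h2 := ln2_ge_half (R := R).
have KS : K%:R <= S.
  have : K%:R * (B%:R * ln 2 - (B%:R + 5) * ln 2 + 3 * ln 2) <= K%:R * (- 1) :> R.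
    rewrite ler_pM2l//; lra.
  lra.
have -> : \sum_(j < K) \sum_z joint (P (j%:R / K%:R)) z * (t z - j%:R / K%:R) ^+ 2 =
    S / K%:R ^+ 2.
  rewrite /S mulr_suml; apply: eq_bigr => k _; rewrite mulr_suml.
  by apply: eq_bigr => z _; field; exact: lt0r_neq0.
by rewrite ler_wpM2r// invr_ge0 sqr_ge0.
Qed.

Lemma centralized_bound : (0 < m)%N ->
  ((40 ^- 2 / 16 * Num.min (sigma ^+ 2 / m%:R) 1)%:E <= worst_case_risk sigma p)%E.
Proof.
move=> m0; have mR : 0 < m%:R :> R by rewrite ltr0n.
set M := Num.min _ _; set k2 := 40 ^- 2.
(* [160] is the [16] of [discrimination_le] times the [10] of [message_law_subgaussian]; the
   discriminations of the [m] machines then sum to at most [1 / 10]. *)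
have k2E : 160 * k2 = 1 / 10 by rewrite /k2; field.
have k20 : 0 < k2 by rewrite invr_gt0 exprn_gt0.
have k2s : Num.sqrt k2 ^+ 2 = k2 by rewrite sqr_sqrtr// ltW.
have ks0 : 0 < Num.sqrt k2 by rewrite sqrtr_gt0.
move: k2E k20 k2s ks0; move: (k2) => {}k2 k2E k20 k2s ks0.
have M0 : 0 < M by rewrite lt_min ltr01 andbT divr_gt0// exprn_gt0.
have M1 : M <= 1 by rewrite ge_min lexx orbT.
have Ms : M <= sigma ^+ 2 / m%:R by rewrite ge_min lexx.
pose del := Num.sqrt M * Num.sqrt k2.
have d0 : 0 < del by rewrite mulr_gt0// sqrtr_gt0.
have dE : del ^+ 2 = M * k2 by rewrite /del exprMn k2s sqr_sqrtr// ltW.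
have d1 : del <= 1.
  rewrite -ler_sqr ?nnegrE; [|lra|lra].
  by rewrite dE expr1n mulr_ile1//; lra.
clearbody del.
apply: (@worst_case_risk_ge _ _ _ _ _ _ (fun v : bool => if v then del else 0)).
- by rewrite card_bool.
- by apply: mulr_ge0; lra.
- by case; apply/andP; split; lra.
move=> t; rewrite card_bool big_bool/= -big_split/=.
have := two_point_risk t 0 del (message_law_pmf 0) (message_law_pmf del).
have rho : ((del - 0) / sigma) ^+ 2 <= k2 / m%:R.
  rewrite subr0 expr_div_n dE ler_pdivrMr ?exprn_gt0//.
  by have := ler_wpM2r (ltW k20) Ms; lra.
have m1 : 1 <= m%:R :> R by rewrite ler1n.
have rho1 : k2 / m%:R <= k2 by rewrite ler_pdivrMr// ler_peMr// ltW.
have D i : discrimination (P 0 i) (P del i) <= 160 * (k2 / m%:R).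
  apply: (le_trans (discrimination_le _ (message_law_pmf _ _) (message_law_pmf _ _)
    (message_law_subgaussian i _))).
  - by rewrite mulr_gt0// exprn_gt0// divr_gt0// subr0.
  - lra.
  - lra.
have : \sum_i discrimination (P 0 i) (P del i) <= 1 / 10.
  apply: (le_trans (ler_sum _ (fun i _ => D i))).
  by rewrite sumr_const card_ord -(mulr_natr (160 * _)) -mulrA divfK ?k2E// gt_eqF.
rewrite subr0 dE => h1 h2.
rewrite [leRHS](_ : _ = \sum_z (joint (P 0) z * (t z - 0) ^+ 2 +
   joint (P del) z * (t z - del) ^+ 2)); last by apply: eq_bigr => z _; rewrite addrC.
apply: le_trans h2; have Mk : 0 < M * k2 by exact: mulr_gt0.
have := ler_wpM2l (ltW Mk) h1; lra.
Qed.

(** The grid of spacing [sigma] fills [[0, 1 / 2]]; the other half of the unit interval is left for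
    the shift by [del]. *)
Lemma exists_grid_size : sigma < 1 -> exists K : nat,
  [/\ (0 < K)%N, 1 / (2 * sigma) <= K%:R & forall k : 'I_K, k%:R * sigma <= 1 / 2].
Proof.
move=> s1.
have h : 0 <= 1 / (2 * sigma) by rewrite divr_ge0// ltW// mulr_gt0.
have /andP[h1 h2] := Num.Theory.truncn_itv h.
exists (Num.truncn (1 / (2 * sigma))).+1; split => //; first exact: ltW.
move=> k; rewrite -ler_pdivlMr// -mulrA -invfM; apply: le_trans h1.
by rewrite ler_nat -ltnS.
Qed.

Lemma localization_bound (n : R) : sigma < 1 -> 2 <= n ->
  B%:R * ln 2 = n * ln 2 - ln sigma ->
  ((40 ^- 2 / 16 * (sigma ^+ 2 / n))%:E <= worst_case_risk sigma p)%E.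
Proof.
move=> s1 n2 nE.
have n0 : 0 < n by lra.
have [K [K0 Kge Kle]] := exists_grid_size s1.
have KR : 0 < K%:R :> R by rewrite ltr0n.
set k2 := 40 ^- 2.
have k2E : 160 * k2 = 1 / 10 by rewrite /k2; field.
have k20 : 0 < k2 by rewrite invr_gt0 exprn_gt0.
move: (k2) k2E k20 => {}k2 k2E k20.
(* [q] is the squared ratio of the shift [del] to [sigma]. *)
pose q := k2 / n.
have qn : q * n = k2 by rewrite divfK// gt_eqF.
have q0 : 0 < q by rewrite divr_gt0.
have q1 : 2 * q <= k2 by rewrite -qn mulrC ler_pM2l.
pose del := sigma * Num.sqrt q.
have d0 : 0 < del by rewrite mulr_gt0// sqrtr_gt0.
have dE : del ^+ 2 = sigma ^+ 2 * q by rewrite /del exprMn sqr_sqrtr// ltW.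
have d1 : del <= 1 / 2.
  rewrite -ler_sqr ?nnegrE; [|lra|lra].
  have -> : (1 / 2) ^+ 2 = 1 * (1 / 4) :> R by field.
  by rewrite dE; apply: ler_pM; [rewrite sqr_ge0|lra|apply: exprn_ile1; [exact: ltW|exact: ltW]|lra].
clearbody del.
pose th (k : 'I_K) (v : bool) : R := k%:R * sigma + v%:R * del.
apply: (@worst_case_risk_ge _ _ _ _ _ _ (fun j : 'I_K * bool => th j.1 j.2)).
- by rewrite card_prod card_ord card_bool muln_gt0 K0.
- by rewrite mulr_ge0// ?divr_ge0 ?sqr_ge0// ltW.
- move=> [k v]; rewrite /th /=; have := Kle k.
  have : 0 <= k%:R * sigma by rewrite mulr_ge0// ltW.
  by case: v; rewrite ?mul1r ?mul0r; lra.
move=> t; rewrite card_prod card_ord card_bool natrM.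
rewrite -(pair_bigA _ (fun k v => \sum_z joint (P (th k v)) z * (t z - th k v) ^+ 2))/=.
pose risk v := \sum_(k < K) \sum_z joint (P (th k v)) z * (t z - th k v) ^+ 2.
have -> : \sum_(k < K) \sum_(v : bool) \sum_z joint (P (th k v)) z * (t z - th k v) ^+ 2 =
    risk true + risk false.
  by rewrite /risk -big_split/=; apply: eq_bigr => k _; rewrite big_bool.
have pmfP v (k : 'I_K) : pmf_on (joint (P (th k v))).
  by apply: joint_pmf => i; exact: message_law_pmf.
have risk0 v : 0 <= risk v.
  apply: sumr_ge0 => k _; apply: sumr_ge0 => z _.
  by rewrite mulr_ge0 ?sqr_ge0// (pmfP v k).1.
have s20 : 0 < sigma ^+ 2 by rewrite exprn_gt0.
pose a := sigma ^+ 2 / n.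
have a0 : 0 < a by rewrite divr_gt0.
have an : a * n = sigma ^+ 2 by rewrite divfK// gt_eqF.
rewrite -/a.
(* A mean risk of order [sigma ^+ 2] already suffices. Otherwise the estimator locates the parameter
   up to [sigma], which limits the entropy of the transcript. *)
have [big|small] := leP (K%:R * 2 * sigma ^+ 2) (risk true + risk false).
  apply: le_trans big; rewrite ler_pM2l ?mulr_gt0//; nra.
pose H v := \sum_(k < K) entropy (joint (P (th k v))).
(* With [ln K%:R >= - ln 2 - ln sigma], the constant of [grid_entropy] is at most [(n + 4) * ln 2]:
   the bits that encode the position on the grid cancel. *)
have HS v : H v <= K%:R * (n + 4) + risk v / sigma ^+ 2.
  have := grid_entropy (fun z => (t z - v%:R * del) / sigma) K0 (pmfP v).
  rewrite ln_card_transcripts -/(H v) nE.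
  have -> : \sum_(k < K) \sum_z joint (P (th k v)) z *
      (k%:R - (t z - v%:R * del) / sigma) ^+ 2 = risk v / sigma ^+ 2.
    rewrite /risk mulr_suml; apply: eq_bigr => k _; rewrite mulr_suml.
    by apply: eq_bigr => z _; rewrite /th; field; exact: lt0r_neq0.
  move=> /le_trans; apply; rewrite lerD2r ler_pM2l//.
  have : - ln 2 - ln sigma <= ln K%:R.
    have -> : - ln 2 - ln sigma = ln (1 / (2 * sigma)).
      by rewrite div1r lnV ?posrE ?mulr_gt0// lnM ?posrE//; lra.
    by rewrite ler_ln ?posrE// divr_gt0// mulr_gt0.
  have := ln2_le1 (R := R); have := ln2_ge_half (R := R); nra.
have two k : del ^+ 2 / 2 * (1 / 2 - 40 * q *
      (entropy (joint (P (th k false))) + entropy (joint (P (th k true))))) <=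
    \sum_z joint (P (th k false)) z * (t z - th k false) ^+ 2 +
    \sum_z joint (P (th k true)) z * (t z - th k true) ^+ 2.
  have thd : th k true - th k false = del by rewrite /th mul1r mul0r; ring.
  have rho : ((th k true - th k false) / sigma) ^+ 2 = q.
    by rewrite thd expr_div_n dE mulrAC divff ?mul1r// gt_eqF.
  have sub i := @message_law_subgaussian (th k false) (th k true) i.
  rewrite rho in sub.
  have := @two_point_entropy_risk _ _ _ (10 * q) _ _ t (th k false) (th k true)
    _ _ (message_law_pmf (th k false)) (message_law_pmf (th k true)).
  rewrite thd => h.
  rewrite (_ : 40 * q = 4 * (10 * q)); last by ring.
  apply: h => [||i]; [lra|lra|].
  by apply: sub; lra.
have : K%:R * (del ^+ 2 / 4) - del ^+ 2 * (20 * q) * (H false + H true) <=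
    risk true + risk false.
  rewrite [leRHS]addrC /risk -big_split/=.
  rewrite /H -big_split/= mulr_sumr -[K in K%:R](card_ord K) mulr_natl -sumr_const -sumrB.
  have alg (x y : R) : x / 4 - x * (20 * q) * y = x / 2 * (1 / 2 - 40 * q * y) by field.
  by apply: ler_sum => k _; rewrite alg; exact: two.
clear two; clearbody H risk.
(* The two bounds [HS] and the small risk give [2 * K%:R * (n + 5)], and [5 <= 5 / 2 * n]. *)
have Hle : H false + H true <= 7 * (K%:R * n).
  have : (risk true + risk false) / sigma ^+ 2 <= K%:R * 2.
    by rewrite ler_pdivrMr// ltW.
  have := ler_wpM2l (ltW KR) n2.
  by have := HS true; have := HS false; lra.
have d2E : del ^+ 2 = a * k2 by rewrite dE /a /q; field; exact: lt0r_neq0.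
have ak : 0 < a * k2 by exact: mulr_gt0.
(* In units of [K%:R * a * k2], the risk is at least [1 / 4 - 140 / 1600 = 13 / 80], above the
   required [1 / 8]. *)
have := ler_wpM2l (ltW (mulr_gt0 ak q0)) Hle.
have -> : a * k2 * q * (7 * (K%:R * n)) = 7 * (a * k2 * K%:R) * (q * n) by ring.
rewrite qn d2E => h1 h2.
have akK : 0 < a * k2 * K%:R by exact: mulr_gt0.
have : 7 * (a * k2 * K%:R) * k2 = 7 * (a * k2 * K%:R) * (1 / 1600).
  by congr (_ * _); lra.
lra.
Qed.

End risk_bounds.

Theorem theorem2 (R : realType) :
  exists c : R, 0 < c /\
    forall (sigma : R) (m : nat) (b : 'I_m -> nat),
      0 < sigma -> (1 <= m)%N -> (forall i, (1 <= b i)%N) ->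
      let B : R := (\sum_(i < m) b i)%N%:R in
      let L : R := log2 sigma^-1 in
      [/\ B < L + 2 ->
            ((c * 2 `^ (- (2 * B)))%:E <= minimax_risk b sigma)%E,
          L + 2 <= B -> B < L + m%:R ->
            ((c * (sigma ^+ 2 / (B - L)))%:E <= minimax_risk b sigma)%E
        & L + m%:R <= B ->
            ((c * Num.min (sigma ^+ 2 / m%:R) 1)%:E <= minimax_risk b sigma)%E].
Proof.
exists (40 ^- 2 / 16); split; first by rewrite divr_gt0// invr_gt0 exprn_gt0.
move=> sigma m b s0 m1 b1 B L.
have minimax_ge (a : R) :
    (forall p : protocol R b, (a%:E <= worst_case_risk sigma p)%E) ->
    (a%:E <= minimax_risk b sigma)%E.
  by move=> ge_a; apply: le_ereal_inf_tmp => _ [p ->].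
split=> [_|BL Bm|_]; apply: minimax_ge => p.
- apply: le_trans (quantization_bound p sigma); rewrite lee_fin ler_wpM2r ?powR_ge0//.
  apply: (@le_trans _ _ (40 ^- 2)).
    by rewrite ler_pdivrMr// ler_peMr ?invr_ge0 ?exprn_ge0// ler1n.
  by rewrite lef_pV2 ?posrE ?exprn_gt0// ler_pXn2r ?nnegrE// ler_nat.
- have ln2 : 0 < ln 2 :> R by have := ln2_ge_half (R := R); lra.
  have Lln : L * ln 2 = - ln sigma by rewrite /L /log2 lnV ?posrE// divfK// gt_eqF.
  apply: localization_bound => //; last 2 first.
  + by lra.
  + by rewrite mulrBl Lln /B; ring.
  (* Each machine sends at least one bit, so [m%:R <= B < L + m%:R]; hence [L > 0], that is
     [sigma < 1]. *)
  have mB : m%:R <= B.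
    rewrite /B ler_nat -[leqLHS]card_ord -sum1_card; exact: leq_sum.
  have L0 : 0 < L by lra.
  rewrite -[sigma]lnK ?posrE// expR_lt1 -oppr_gt0 -Lln; exact: mulr_gt0.
- exact: centralized_bound.
Qed.
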